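(* Every smooth surface $\Sigma\subset\mathbb{L}(\mathbb{H}^3)$ of rank one on which the metric induced by the canonical neutral Kähler metric $\mathbb{G}$ is non-degenerate is marginally trapped, i.e. its mean curvature vector $\vec H$ satisfies $\mathbb{G}(\vec H,\vec H)=0$ at every point.
   Context: The space $\mathbb{L}(\mathbb{H}^3)$ of oriented geodesics of hyperbolic 3-space is identified, as a complex surface, with $\mathbb{P}^1\times\mathbb{P}^1-\overline\Delta$, where in holomorphic coordinates $(\mu_1,\mu_2)$ the reflected diagonal is $\overline\Delta=\{(\mu_1,\mu_2):\mu_1\bar\mu_2=-1\}$. The canonical neutral (signature $(2,2)$) Kähler metric is $$\mathbb{G}=\mathrm{Im}\left[\frac{2}{(1+\mu_1\bar\mu_2)^2}\,d\mu_1\otimes d\bar\mu_2\right],$$ where the product of one-forms is understood as symmetrised. For an immersed surface $\Sigma$ in $\mathbb{L}(\mathbb{H}^3)$, let $\pi_j$ ($j=1,2$) be the projection onto the $j$-th factor of $\mathbb{P}^1\times\mathbb{P}^1-\overline\Delta$. The rank of $\Sigma$ at a point is the smaller of the ranks of the differentials of $\pi_1|_\Sigma$ and $\pi_2|_\Sigma$ at that point. Rank one means rank one at every point. The surface is not assumed to be Lagrangian. By choice of orientation of the geodesics, one may define the rank to be the rank of the projection onto the first factor; a rank one surface can be locally parametrised by $\mu_1=\mu_1(s)$, $\mu_2=\mu_2(s,t)$. A surface is marginally trapped if its mean curvature vector (the trace of the second fundamental form with respect to the induced metric) is null; the zero vector counts as null. *)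

(* Defs.v *)
From HB Require Import structures.
From mathcomp Require Import all_boot all_order all_algebra.
From mathcomp Require Import all_classical all_reals all_analysis.
From mathcomp Require Import complex.
From mathcomp Require Import ring.

Set Implicit Arguments.
Unset Strict Implicit.
Unset Printing Implicit Defensive.

Import Order.TTheory GRing.Theory Num.Theory.
Import numFieldNormedType.Exports.

Local Open Scope classical_set_scope.
Local Open Scope ring_scope.
Local Open Scope complex_scope.

Definition partial (R : realType) (m n : nat) (a : 'I_m)
  (f : 'rV[R]_m -> 'rV[R]_n) : 'rV[R]_m -> 'rV[R]_n :=
  fun x => 'D_(delta_mx 0 a) f x.

(* C^infinity on the open set U: the partial derivatives of all orders are
   differentiable at the points of U. *)
Definition smooth_on (R : realType) (m n : nat) (U : set 'rV[R]_m)
  (f : 'rV[R]_m -> 'rV[R]_n) : Prop :=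
  forall (s : seq 'I_m) (x : 'rV[R]_m), U x ->
    differentiable (foldr (@partial R m n) f s) x.

Record smooth_surface (R : realType) := SmoothSurface {
  carrier :> topologicalType;
  carrier_hausdorff : hausdorff_space carrier;
  carrier_second_countable : @second_countable carrier;
  chart : Type;
  chart_dom : chart -> set 'rV[R]_2;
  chart_par : chart -> 'rV[R]_2 -> carrier;
  chart_coord : chart -> carrier -> 'rV[R]_2;
  chart_dom_open : forall i, open (chart_dom i);
  chart_parK : forall i x, chart_dom i x -> chart_coord i (chart_par i x) = x;
  chart_par_continuous : forall i x, chart_dom i x ->
    {for x, continuous (chart_par i)};
  chart_par_open : forall i (U : set 'rV[R]_2),
    open U -> U `<=` chart_dom i -> open (chart_par i @` U);
  chart_cover : forall p, exists i, (chart_par i @` chart_dom i) p;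
  chart_transition : forall i j,
    smooth_on
      (chart_dom i `&` chart_par i @^-1` (chart_par j @` chart_dom j))
      (chart_coord j \o chart_par i)
}.

Section PseudoRiemannian.
Variables (R : realType) (m n : nat).

(* A metric on a domain of 'rV[R]_n is given by its matrix g of components. *)

(* Gamma^k_ij *)
Definition christoffel (g : 'rV[R]_n -> 'M[R]_n) (x : 'rV[R]_n)
  (k i j : 'I_n) : R :=
  2^-1 * \sum_(l < n) invmx (g x) k l *
    ('D_(delta_mx 0 i) (fun y => g y j l) x
     + 'D_(delta_mx 0 j) (fun y => g y i l) x
     - 'D_(delta_mx 0 l) (fun y => g y i j) x).

(* Row a of 'J F x is the tangent vector d_a F. *)
Definition induced_metric (g : 'rV[R]_n -> 'M[R]_n)
  (F : 'rV[R]_m -> 'rV[R]_n) (x : 'rV[R]_m) : 'M[R]_m :=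
  'J F x *m g (F x) *m ('J F x)^T.

(* nabla_(d_a F) (d_b F) for the Levi-Civita connection of g *)
Definition covariant_derivative (g : 'rV[R]_n -> 'M[R]_n)
  (F : 'rV[R]_m -> 'rV[R]_n) (x : 'rV[R]_m) (a b : 'I_m) : 'rV[R]_n :=
  partial a (partial b F) x +
  \row_k \sum_(i < n) \sum_(j < n)
    christoffel g (F x) k i j * 'J F x a i * 'J F x b j.

(* g-orthogonal projection along the tangent space, where the induced metric
   is non-degenerate *)
Definition normal_part (g : 'rV[R]_n -> 'M[R]_n)
  (F : 'rV[R]_m -> 'rV[R]_n) (x : 'rV[R]_m) (v : 'rV[R]_n) : 'rV[R]_n :=
  v - v *m g (F x) *m ('J F x)^T *m invmx (induced_metric g F x) *m 'J F x.

Definition second_fundamental_form (g : 'rV[R]_n -> 'M[R]_n)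
  (F : 'rV[R]_m -> 'rV[R]_n) (x : 'rV[R]_m) (a b : 'I_m) : 'rV[R]_n :=
  normal_part g F x (covariant_derivative g F x a b).

Definition mean_curvature (g : 'rV[R]_n -> 'M[R]_n)
  (F : 'rV[R]_m -> 'rV[R]_n) (x : 'rV[R]_m) : 'rV[R]_n :=
  \sum_(a < m) \sum_(b < m)
    invmx (induced_metric g F x) a b *: second_fundamental_form g F x a b.

Definition metric_sqnorm (g : 'rV[R]_n -> 'M[R]_n) (x v : 'rV[R]_n) : R :=
  (v *m g x *m v^T) 0 0.

End PseudoRiemannian.

Section OrientedGeodesics.
Variable R : realType.

(* None is the point at infinity. *)
Definition P1 := option R[i].

(* mu1 * conj(mu2) = -1, closed up by (0, oo) and (oo, 0): the pairs of
   antipodal points of the sphere. *)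
Definition reflected_diagonal (p : P1 * P1) : bool :=
  match p with
  | (Some mu1, Some mu2) => mu1 * conjc mu2 == -1
  | (Some mu1, None) => mu1 == 0
  | (None, Some mu2) => mu2 == 0
  | (None, None) => false
  end.

Definition LH3 := {p : P1 * P1 | ~~ reflected_diagonal p}.

(* The chart false of P1 is mu on P1 - {oo}; the chart true is 1 / mu on
   P1 - {0}. *)
Definition P1_dom (b : bool) (p : P1) : bool :=
  if b then p != Some 0 else p != None.

Definition P1_coord (b : bool) (p : P1) : R[i] :=
  if p is Some mu then (if b then mu^-1 else mu) else 0.

Definition realify (z : R[i]) : 'rV[R]_2 :=
  \row_(k < 2) if k == 0 then complex.Re z else complex.Im z.

Definition complexify (u : 'rV[R]_2) : R[i] := u 0 0 +i* u 0 1.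

Definition LH3_dom (c : bool * bool) (p : LH3) : bool :=
  P1_dom c.1 (val p).1 && P1_dom c.2 (val p).2.

Definition LH3_coord (c : bool * bool) (p : LH3) : 'rV[R]_(2 + 2) :=
  row_mx (realify (P1_coord c.1 (val p).1)) (realify (P1_coord c.2 (val p).2)).

(* Value at the tangent vectors (X1, X2), (Y1, Y2), in the coordinates
   (z1, z2) of the chart c.  For c = (false, false) this is
     Im [2 / (1 + mu1 conj(mu2))^2 d mu1 (x) d conj(mu2)]
   with the product symmetrised as
     (d mu1 (x) d conj(mu2) + d conj(mu2) (x) d mu1) / 2;
   in the other charts it is what this formula becomes under
   z = 1 / mu, cf. neutral_form_inv1 and neutral_form_inv2. *)
Definition neutral_form (c : bool * bool) (z1 z2 X1 X2 Y1 Y2 : R[i]) : R :=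
  let sym := (X1 * conjc Y2 + Y1 * conjc X2) / 2 in
  complex.Im (if c.1 == c.2 then 2 / (1 + z1 * conjc z2) ^+ 2 * sym
              else - 2 / (z1 + conjc z2) ^+ 2 * sym).

Lemma neutral_form_inv1 b1 b2 (z1 z2 X1 X2 Y1 Y2 : R[i]) : z1 != 0 ->
  neutral_form (~~ b1, b2) z1^-1 z2 (- X1 / z1 ^+ 2) X2 (- Y1 / z1 ^+ 2) Y2 =
  neutral_form (b1, b2) z1 z2 X1 X2 Y1 Y2.
Proof.
move=> z1_neq0; rewrite /neutral_form /=; congr complex.Im.
have eqD : z1^-1 + conjc z2 = (1 + z1 * conjc z2) / z1 by field.
have eqD' : 1 + z1^-1 * conjc z2 = (z1 + conjc z2) / z1 by field.
rewrite eqD eqD' -!exprVn !invfM !invrK.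
move: (1 + z1 * conjc z2)^-1 (z1 + conjc z2)^-1 => D D'.
by case: b1 b2 => [] [] /=; field.
Qed.

Lemma neutral_form_inv2 b1 b2 (z1 z2 X1 X2 Y1 Y2 : R[i]) : z2 != 0 ->
  neutral_form (b1, ~~ b2) z1 z2^-1 X1 (- X2 / z2 ^+ 2) Y1 (- Y2 / z2 ^+ 2) =
  neutral_form (b1, b2) z1 z2 X1 X2 Y1 Y2.
Proof.
move=> z2_neq0; rewrite /neutral_form /=; congr complex.Im.
have w2_neq0 : conjc z2 != 0 by rewrite conjc_eq0.
have conjM X : conjc (- X / z2 ^+ 2) = - conjc X / (conjc z2) ^+ 2.
  by rewrite rmorphM rmorphN /= conjc_inv rmorphXn.
rewrite conjc_inv !conjM.
move: (conjc z2) w2_neq0 (conjc X2) (conjc Y2) => w w_neq0 X Y.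
have eqD : z1 + w^-1 = (1 + z1 * w) / w by field.
have eqD' : 1 + z1 * w^-1 = (z1 + w) / w by field.
rewrite eqD eqD' -!exprVn !invfM !invrK.
move: (1 + z1 * w)^-1 (z1 + w)^-1 => D D'.
by case: b1 b2 => [] [] /=; field.
Qed.

Definition neutral_metric (c : bool * bool) (x : 'rV[R]_(2 + 2)) :
  'M[R]_(2 + 2) :=
  \matrix_(i, j)
    let e k : 'rV[R]_(2 + 2) := delta_mx 0 k in
    neutral_form c (complexify (lsubmx x)) (complexify (rsubmx x))
      (complexify (lsubmx (e i))) (complexify (rsubmx (e i)))
      (complexify (lsubmx (e j))) (complexify (rsubmx (e j))).

Section Surface.
Variables (M : smooth_surface R) (f : M -> LH3).

Definition rep_dom (i : chart M) (c : bool * bool) : set 'rV[R]_2 :=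
  [set x | chart_dom i x /\ LH3_dom c (f (chart_par i x))].

Definition rep (i : chart M) (c : bool * bool) : 'rV[R]_2 -> 'rV[R]_(2 + 2) :=
  fun x => LH3_coord c (f (chart_par i x)).

(* The differentials are taken in all charts of M and of LH3; the conditions
   below do not depend on the charts around a given point. *)

(* Openness of the domains of the local representatives is continuity of f. *)
Definition immersion : Prop :=
  forall i c, [/\ open (rep_dom i c), smooth_on (rep_dom i c) (rep i c) &
    forall x, rep_dom i c x -> \rank ('J (rep i c) x) = 2%N].

(* The left and right halves of the Jacobian matrix are the matrices of the
   differentials of the two projections. *)
Definition rank_one : Prop :=
  forall i c x, rep_dom i c x ->
    minn (\rank (lsubmx ('J (rep i c) x)))
         (\rank (rsubmx ('J (rep i c) x))) = 1%N.

Definition nondegenerate_induced_metric : Prop :=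
  forall i c x, rep_dom i c x ->
    induced_metric (neutral_metric c) (rep i c) x \in unitmx.

Definition marginally_trapped : Prop :=
  forall i c x, rep_dom i c x ->
    metric_sqnorm (neutral_metric c) (rep i c x)
      (mean_curvature (neutral_metric c) (rep i c) x) = 0.

End Surface.
End OrientedGeodesics.

(* Main.v *)
(* Write u, v for the two components of the surface in the coordinates z1 and
   conjc z2, in which the metric is Im [h du dv] with h holomorphic.  As the
   rank is one, det du * det dv = 0, hence at each point one of the factors, say
   P = det du, vanishes together with its first derivatives, also at a point
   where P and Q = det dv both vanish, because there P Q = 0 forces
   dP(w) dQ(w) = 0 for all w.  Let k span the kernel of du; then dP = 0 says
   that the vectors Hess u (k, w) lie in the line du(R^2).  Let N be the plane
   du = 0 of tangent vectors of the ambient space, which is totally null and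
   equal to its orthogonal.
   The tangent vector dF(k) lies in N, so it is null, and the trace with respect
   to the induced metric only involves nabla_k dF(w); since h is holomorphic, N
   is parallel and Gamma (N, .) lies in N.  Therefore the trace of nabla dF lies
   in N modulo tangent vectors.  The tangential part of a vector of N is
   orthogonal to dF(k), so it is a multiple of dF(k) and lies in N too.  Hence
   the mean curvature vector lies in N and is null. *)

Require Import Defs.
From mathcomp Require Import all_boot all_order all_algebra.
From mathcomp Require Import all_classical all_reals all_analysis.
From mathcomp Require Import complex.
From mathcomp Require Import ring.

Set Implicit Arguments.
Unset Strict Implicit.
Unset Printing Implicit Defensive.

Import Order.TTheory GRing.Theory Num.Theory.
Import numFieldNormedType.Exports.

Local Open Scope classical_set_scope.
Local Open Scope ring_scope.
Local Open Scope complex_scope.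

(** * Second derivatives *)

Section SecondDerivatives.
Variables (R : realType) (V : normedModType R).

Lemma differentiable_near_le (g : V -> R) (x : V) (e : R) :
  differentiable g x -> 0 < e ->
  \forall v \near 0, `|g (x + v) - g x - 'd g x v| <= e * `|v|.
Proof.
move=> dg e0.
have /eqaddoP/(_ _ e0) := diff_locally dg.
apply: filterS => v /=.
by rewrite !fctE opprD addrA (addrC v).
Qed.

Lemma is_derive_line (f : V -> R) (x b : V) (s : R) :
  differentiable f (x + s *: b) ->
  is_derive s 1 (fun r => f (x + r *: b)) ('D_b f (x + s *: b)).
Proof.
move=> /(diff_derivable (v := b)) df.
have eqf : (fun h : R =>
    h^-1 *: (f (x + (h *: (1 : R) + s) *: b) - f (x + s *: b)))
  = (fun h : R => h^-1 *: (f (h *: b + (x + s *: b)) - f (x + s *: b))).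
  apply/funext => h; congr (_ *: (f _ - _)).
  by rewrite [h *: 1]mulr1 scalerDl addrCA.
apply: DeriveDef.
  by rewrite /derivable /= eqf; exact: df.
by rewrite /derive /= eqf.
Qed.

(** The mean value theorem along [b] turns the second difference into [t] times a difference of two
    values of [g], which the first-order expansion of [g] at [x] estimates. *)
Lemma second_difference (f g : V -> R) (x a b : V) (e : R) :
  (\forall y \near x, differentiable f y /\ 'D_b f y = g y) ->
  differentiable g x -> 0 < e ->
  \forall t \near (0 : R)^'+,
    `|f (x + t *: a + t *: b) - f (x + t *: a) - f (x + t *: b) + f x
      - t ^+ 2 * 'D_a g x| <= e * t ^+ 2.
Proof.
move=> df dg e0.
(* Per unit of [t], [K] bounds the sum of the norms of [t *: a + c *: b] and [c *: b], the
   increments at which [g] is expanded; [K + 1] keeps the divisor positive. *)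
pose K := `|a| + `|b| + `|b|.
have K0 : 0 <= K by rewrite !addr_ge0.
have eta0 : 0 < e / (K + 1) by rewrite divr_gt0 // ltr_wpDl.
have /nbhs_ballP[d1 /= d10 df1] := df.
have /nbhs_ballP[d2 /= d20 dg2] := differentiable_near_le dg eta0.
near=> t.
have t0 : 0 < t by near: t; exact: nbhs_right_gt.
have tK : t * (K + 1) < Num.min d1 d2.
  rewrite -ltr_pdivlMr ?ltr_wpDl //; near: t; apply: nbhs_right_lt.
  by rewrite divr_gt0 ?ltr_wpDl // lt_min d10.
have normle (r s : R) : 0 <= r <= t -> 0 <= s <= t ->
    `|r *: a + s *: b| <= t * (`|a| + `|b|).
  move=> /andP[r0 rt] /andP[s0 st]; rewrite (le_trans (ler_normD _ _)) //.
  by rewrite !normrZ !ger0_norm // mulrDr lerD // ler_wpM2r.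
have normlt (r s : R) : 0 <= r <= t -> 0 <= s <= t ->
    `|r *: a + s *: b| < Num.min d1 d2.
  move=> hr hs; apply: le_lt_trans tK; rewrite (le_trans (normle _ _ hr hs)) //.
  by rewrite ler_pM2l // /K -addrA lerDl addr_ge0.
have dfrs (r s : R) : 0 <= r <= t -> 0 <= s <= t ->
    differentiable f (x + r *: a + s *: b) /\
    'D_b f (x + r *: a + s *: b) = g (x + r *: a + s *: b).
  move=> hr hs; apply: df1; rewrite -ball_normE /= -addrA opprD addNKr normrN.
  by have := normlt _ _ hr hs; rewrite lt_min => /andP[].
have tt : 0 <= t <= t by rewrite lexx ltW.
have zt : 0 <= (0:R) <= t by rewrite lexx ltW.
pose phi (s : R) := f (x + t *: a + s *: b) - f (x + s *: b).
have dphi (s : R) : 0 <= s <= t ->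
    is_derive s 1 phi (g (x + t *: a + s *: b) - g (x + s *: b)).
  move=> hs; have [df1s g1s] := dfrs _ _ tt hs.
  have := dfrs _ _ zt hs; rewrite scale0r addr0 => -[df0s g0s].
  by rewrite -g1s -g0s; apply: is_deriveB; apply: is_derive_line.
have [|||c] := @MVT R phi
  (fun s => g (x + t *: a + s *: b) - g (x + s *: b)) 0 t.
- exact: t0.
- by move=> s; rewrite in_itv /= => /andP[s0 st]; apply: dphi; rewrite !ltW.
- apply: derivable_within_continuous => s; rewrite in_itv /= => hs.
  by have [] := dphi _ hs.
rewrite in_itv /= => /andP[/ltW c0 /ltW ct].
have ct' : 0 <= c <= t by rewrite c0.
rewrite /phi scale0r !addr0 subr0 => phiE.
have -> : f (x + t *: a + t *: b) - f (x + t *: a) - f (x + t *: b) + f x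
   = (g (x + t *: a + c *: b) - g (x + c *: b)) * t by rewrite -phiE; ring.
have ball2 (r s : R) : 0 <= r <= t -> 0 <= s <= t ->
    ball 0 d2 (r *: a + s *: b).
  move=> hr hs; rewrite -ball_normE /= sub0r normrN.
  by have := normlt _ _ hr hs; rewrite lt_min => /andP[].
have dE (r s : R) : 'd g x (r *: a + s *: b) = r * 'd g x a + s * 'd g x b.
  by rewrite linearD !linearZ.
have h1 : `|g (x + t *: a + c *: b) - g x - (t * 'd g x a + c * 'd g x b)|
    <= e / (K + 1) * `|t *: a + c *: b|.
  by rewrite -dE -[x + _ + _]addrA; exact: dg2 (ball2 _ _ tt ct').
have h2 : `|g (x + c *: b) - g x - c * 'd g x b| <= e / (K + 1) * `|c *: b|.
  have := dg2 _ (ball2 _ _ zt ct'); rewrite dE.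
  by rewrite scale0r mul0r !add0r.
rewrite (deriveE _ dg).
have n1 := normle _ _ tt ct'.
have n2 : `|c *: b| <= t * `|b|.
  by rewrite normrZ ger0_norm // ler_wpM2r.
have -> : (g (x + t *: a + c *: b) - g (x + c *: b)) * t - t ^+ 2 * 'd g x a =
  t * ((g (x + t *: a + c *: b) - g x - (t * 'd g x a + c * 'd g x b)) -
       (g (x + c *: b) - g x - c * 'd g x b)) by ring.
rewrite normrM gtr0_norm // expr2 mulrCA ler_pM2l //.
apply: le_trans (ler_normB _ _) _.
apply: le_trans (lerD h1 h2) _.
rewrite -mulrDr mulrAC ler_pdivrMr ?ltr_wpDl // -mulrA ler_pM2l //.
apply: le_trans (lerD n1 n2) _.
by rewrite -mulrDr ler_pM2l // /K lerDl.
Unshelve. all: by end_near.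
Qed.

(** The second difference is symmetric in [a] and [b], so both derivatives are within [e / 2] of the
    same quotient by [t ^+ 2]. *)
Lemma derive_derive_sym (f g h : V -> R) (x a b : V) :
  (\forall y \near x, differentiable f y) ->
  (\forall y \near x, 'D_a f y = g y) -> (\forall y \near x, 'D_b f y = h y) ->
  differentiable g x -> differentiable h x -> 'D_b g x = 'D_a h x.
Proof.
move=> df fg fh dg dh; apply/eqP; rewrite -subr_eq0 -normr_le0.
apply/ler_addgt0Pl => e e0; rewrite addr0.
have e20 : 0 < e / 2 by rewrite divr_gt0.
have [t [[h1 h2] t0]] := filter_ex (filterI (filterI
  (second_difference a (filterI df fh) dh e20)
  (second_difference b (filterI df fg) dg e20))
  (nbhs_right_gt (0 : R))).
have t20 : 0 < t ^+ 2 by rewrite exprn_gt0.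
rewrite -(ler_pM2r t20) -{1}(gtr0_norm t20) -normrM.
have eqS : f (x + t *: b + t *: a) = f (x + t *: a + t *: b) by rewrite addrAC.
move: h1 h2; rewrite /= eqS => h1 h2.
have := le_trans (ler_normB _ _) (lerD h1 h2).
rewrite -mulrDl -splitr; congr (`|_| <= _); ring.
Qed.

End SecondDerivatives.

(** * Pairs of functions with vanishing product *)

(** As [p] and [q] vanish at [x], the product of their difference quotients is a multiple of [p * q]
    at a nearby point, hence zero. *)
Lemma derive_mul_eq0 (R : realType) (V : normedModType R) (p q : V -> R)
    (x v : V) :
  differentiable p x -> differentiable q x -> p x = 0 -> q x = 0 ->
  (\forall y \near x, p y * q y = 0) -> 'D_v p x * 'D_v q x = 0.
Proof.
move=> /(diff_derivable (v := v)) dp /(diff_derivable (v := v)) dq p0 q0 pq.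
apply: (@cvg_unique _ (@Rhausdorff R) ((fun h : R =>
  (h^-1 *: (p (h *: v + x) - p x)) * (h^-1 *: (q (h *: v + x) - q x))) @ 0^')).
  exact: cvgM dp dq.
rewrite p0 q0; apply: cvg_near_cst.
have : (fun h : R => h *: v + x) @ 0 --> x.
  rewrite -[X in _ --> X]add0r -(scale0r v).
  by apply: cvgD; [exact: cvgZr_tmp | exact: cvg_cst].
move=> /(_ _ pq); rewrite /= nbhs_simpl /= => /nbhs_dnbhs.
apply: filterS => h pq0.
by rewrite !subr0 /GRing.scale /= mulrACA pq0 mulr0.
Qed.

Lemma factor_vanishes_order1 (R : realType) (V : normedModType R)
    (p q : V -> R) (x : V) :
  differentiable p x -> differentiable q x ->
  (\forall y \near x, p y * q y = 0) ->
  (p x = 0 /\ forall v, 'D_v p x = 0) \/ (q x = 0 /\ forall v, 'D_v q x = 0).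
Proof.
move=> dp dq pq.
have aux (p' q' : V -> R) : differentiable p' x -> p' x != 0 ->
    (\forall y \near x, p' y * q' y = 0) ->
    q' x = 0 /\ forall v, 'D_v q' x = 0.
  move=> /differentiable_continuous cp p0 pq'.
  have q'0 : \forall y \near x, q' y = 0.
    have : \forall y \near x, p' y != 0 by exact: (cvgr_neq0 _ cp p0).
    apply: filterS2 pq' => y /eqP; rewrite mulf_eq0.
    by case/orP => /eqP // ->; rewrite eqxx.
  split; first exact: nbhs_singleton q'0.
  by move=> v; rewrite (near_eq_derive v q'0) derive_cst.
have [p0|p0] := eqVneq (p x) 0; last by right; exact: aux dp p0 pq.
have [q0|q0] := eqVneq (q x) 0; last first.
  by left; apply: (aux q p) => //; apply: filterS pq => y; rewrite mulrC.
have [p'0|] := pselect (forall v, 'D_v p x = 0); first by left.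
have [q'0|] := pselect (forall v, 'D_v q x = 0); first by right.
(* Otherwise both differentials are nonzero, at [a] and at [b], while their product is zero on every
   vector; neither of them would vanish on [a + b]. *)
move=> /existsNP[b /eqP qb] /existsNP[a /eqP pa].
have pq' v : 'D_v p x = 0 \/ 'D_v q x = 0.
  have /eqP := derive_mul_eq0 v dp dq p0 q0 pq.
  by rewrite mulf_eq0 => /orP[] /eqP; [left | right].
have qa : 'D_a q x = 0 by case: (pq' a) => // pa0; rewrite pa0 eqxx in pa.
have pb : 'D_b p x = 0 by case: (pq' b) => // qb0; rewrite qb0 eqxx in qb.
have derD (g : V -> R) : differentiable g x ->
    'D_(a + b) g x = 'D_a g x + 'D_b g x.
  by move=> dg; rewrite !deriveE // linearD.
case: (pq' (a + b)); rewrite derD //.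
  by rewrite pb addr0 => pa0; rewrite pa0 eqxx in pa.
by rewrite qa add0r => qb0; rewrite qb0 eqxx in qb.
Qed.

(** * Linear algebra of a tangent plane meeting a null subspace *)

Section LinearAlgebra.
Variable R : realFieldType.

Lemma ord2P (i : 'I_2) : i = 0 \/ i = 1.
Proof. by case: i => [[|[|//]]] p; [left | right]; exact/val_inj. Qed.

Lemma sum_ord2 (V : nmodType) (F : 'I_2 -> V) : \sum_i F i = F 0 + F 1.
Proof.
by rewrite !big_ord_recl big_ord0 addr0; congr (_ + F _); exact/val_inj.
Qed.

Lemma colinear_row2 (u v : 'rV[R]_2) : u != 0 ->
  v 0 0 * u 0 1 = v 0 1 * u 0 0 -> (v <= u)%MS.
Proof.
move=> u0 uv; apply/sub_rVP.
have [u00|u00] := eqVneq (u 0 0) 0; last first.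
  exists (v 0 0 / u 0 0); apply/rowP => j; rewrite !mxE.
  by case: (ord2P j) => ->; rewrite ?divfK // mulrAC uv mulfK.
have u01 : u 0 1 != 0.
  apply: contraNneq u0 => u01; apply/eqP/rowP => j; rewrite !mxE.
  by case: (ord2P j) => ->.
exists (v 0 1 / u 0 1); apply/rowP => j; rewrite !mxE.
by case: (ord2P j) => ->; rewrite ?divfK // mulrAC -uv mulfK.
Qed.

(* The last hypothesis says that the derivative of [\det] at [U] in the
   direction [H] vanishes. *)
Lemma kermx_deriv_det (U H : 'M[R]_2) (k : 'rV[R]_2) : U != 0 -> k *m U = 0 ->
  H 0 0 * U 1 1 + U 0 0 * H 1 1 - (H 0 1 * U 1 0 + U 0 1 * H 1 0) = 0 ->
  (k *m H <= U)%MS.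
Proof.
move=> U0 kU dH.
have kUE j : k 0 0 * U 0 j + k 0 1 * U 1 j = 0.
  by have /rowP/(_ j) := kU; rewrite !mxE sum_ord2.
have [i Ui] : exists i, row i U != 0.
  apply/existsP; apply: contraR U0 => /existsPn h; apply/eqP/row_matrixP => i.
  by rewrite row0; apply/eqP/negPn/h.
apply: submx_trans (row_sub i U); apply: colinear_row2 => //.
rewrite !mxE !sum_ord2.
apply/eqP; rewrite -subr_eq0; apply/eqP; case: (ord2P i) => ->.
  (* The minor of [k *m H] and a row of [U] is a combination of the entries of [k *m U] and the
     derivative of the determinant. *)
  transitivity (H 0 0 * (k 0 0 * U 0 1 + k 0 1 * U 1 1)
    - H 0 1 * (k 0 0 * U 0 0 + k 0 1 * U 1 0) - k 0 1 *
    (H 0 0 * U 1 1 + U 0 0 * H 1 1 - (H 0 1 * U 1 0 + U 0 1 * H 1 0))).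
    by ring.
  by rewrite !kUE dH; ring.
transitivity (H 1 0 * (k 0 0 * U 0 1 + k 0 1 * U 1 1)
  - H 1 1 * (k 0 0 * U 0 0 + k 0 1 * U 1 0) + k 0 0 *
  (H 0 0 * U 1 1 + U 0 0 * H 1 1 - (H 0 1 * U 1 0 + U 0 1 * H 1 0))).
  by ring.
by rewrite !kUE dH; ring.
Qed.

(* A symmetric form for which [k] is null induces on the dual space a form
   which vanishes on the annihilator of [k], hence is a multiple of [k] in the
   symmetric algebra. *)
Lemma invmx_isotropic (I : 'M[R]_2) (k : 'rV[R]_2) : I^T = I ->
  I \in unitmx -> k != 0 -> k *m I *m k^T = 0 ->
  exists y : 'rV[R]_2, invmx I = k^T *m y + y^T *m k.
Proof.
move=> symI uI k0 kIk; set A := invmx I; pose m := k *m I.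
have symA : A 1 0 = A 0 1 by rewrite -[A in LHS]trmxK mxE /A trmx_inv symI.
have mA j : m 0 0 * A 0 j + m 0 1 * A 1 j = k 0 j.
  have /rowP/(_ j) : m *m A = k by rewrite /m -mulmxA mulmxV // mulmx1.
  by rewrite mxE sum_ord2.
have mk : m 0 0 * k 0 0 + m 0 1 * k 0 1 = 0.
  by have /matrixP/(_ 0 0) := kIk; rewrite mxE sum_ord2 !mxE.
(* The dual form [A] takes the value [m *m k^T] on [m], since [m *m A = k]. *)
have mAm : m 0 0 ^+ 2 * A 0 0 + 2 * m 0 0 * m 0 1 * A 0 1
    + m 0 1 ^+ 2 * A 1 1 = 0.
  rewrite -mk -!mA symA; ring.
have k_neq0 : k 0 0 != 0 \/ k 0 0 = 0 /\ k 0 1 != 0.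
  have [k00|] := eqVneq (k 0 0) 0; last by left.
  right; split=> //; apply: contraNneq k0 => k01; apply/eqP/rowP => j.
  by rewrite mxE; case: (ord2P j) => ->.
case: k_neq0 => [k00|[k00 k01]].
  have m0E : m 0 0 = - (m 0 1 * k 0 1) / k 0 0.
    by apply: (mulIf k00); rewrite divfK //; apply/eqP; rewrite -addr_eq0 mk.
  have m1 : m 0 1 != 0.
    apply: contraNneq k00 => m1.
    by rewrite -mA m0E m1 !mul0r oppr0 !mul0r addr0.
  (* Since [m] is proportional to [(- k 0 1, k 0 0)], [mAm] expresses [A 1 1] through the other
     entries. *)
  have A11 : A 1 1 = 2 * k 0 1 / k 0 0 * A 0 1 - (k 0 1 / k 0 0) ^+ 2 * A 0 0.
    apply: (mulfI (expf_neq0 2 m1)).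
    apply/eqP; rewrite -subr_eq0 -mAm m0E; apply/eqP; field.
    exact: k00.
  (* Entries [(0, 0)] and [(0, 1)] of the equation determine [y]; entry [(1, 1)] then amounts to
     [A11]. *)
  pose y0 := A 0 0 / (2 * k 0 0).
  exists (\row_j if j == 0 then y0 else (A 0 1 - k 0 1 * y0) / k 0 0).
  apply/matrixP => i j; rewrite !mxE !big_ord1 !mxE /y0.
  case: (ord2P i) => ->; case: (ord2P j) => -> /=; rewrite ?symA ?A11; field;
  exact: k00.
have m1 : m 0 1 = 0.
  by apply/eqP; move/eqP: mk; rewrite k00 mulr0 add0r mulf_eq0 (negPf k01) orbF.
have m0 : m 0 0 != 0.
  by apply: contraNneq k01 => m0; rewrite -mA m0 m1 !mul0r addr0.
have A00 : A 0 0 = 0.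
  apply/eqP; move/eqP: mAm; rewrite m1 mulr0 expr0n /= !mul0r !addr0.
  by rewrite mulf_eq0 expf_eq0 (negPf m0) andbF.
exists (\row_j if j == 0 then A 0 1 / k 0 1 else A 1 1 / (2 * k 0 1)).
apply/matrixP => i j; rewrite !mxE !big_ord1 !mxE.
by case: (ord2P i) => ->; case: (ord2P j) => -> /=; rewrite ?symA ?A00 ?k00;
  field.
Qed.

(* [N] is the common kernel of the columns of [P]; it is totally null, and the
   tangent plane, spanned by the rows of [J], meets it along [k *m J]. *)
Lemma null_trace (n p : nat) (G : 'M[R]_n) (J : 'M[R]_(2, n))
    (P : 'M[R]_(n, p)) (T : 'I_2 -> 'I_2 -> 'rV[R]_n) (k : 'rV[R]_2) :
  let I := J *m G *m J^T in
  let H := \sum_a \sum_b invmx I a b *: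
    (T a b - T a b *m G *m J^T *m invmx I *m J) in
  G^T = G -> I \in unitmx ->
  (forall v w : 'rV[R]_n, v *m P = 0 -> w *m P = 0 -> v *m G *m w^T = 0) ->
  k != 0 -> k *m J *m P = 0 ->
  (forall a b, T a b = T b a) ->
  (forall a, ((\sum_b k 0 b *: T a b) *m P <= J *m P)%MS) ->
  H *m G *m H^T = 0.
Proof.
move=> I H symG uI nullP k0 kJP symT TP.
have IE : I = J *m G *m J^T by [].
clearbody I.
have symI : I^T = I by rewrite IE !trmx_mul trmxK symG mulmxA.
have kIk : k *m I *m k^T = 0.
  by have := nullP _ _ kJP kJP; rewrite trmx_mul IE !mulmxA.
have [y yE] := invmx_isotropic symI uI k0 kIk.
pose W := \sum_a \sum_b invmx I a b *: T a b.
have HE : H = W - W *m G *m J^T *m invmx I *m J.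
  rewrite /H /W !mulmx_suml -sumrB; apply: eq_bigr => a _.
  rewrite !mulmx_suml -sumrB; apply: eq_bigr => b _.
  by rewrite scalerBr -!scalemxAl.
have [z zE] : exists z, W *m P = z *m (J *m P).
  apply/submxP.
  (* The two summands of [k^T *m y + y^T *m k] contribute equally because [T] is symmetric. *)
  have -> : W = \sum_a (2 * y 0 a) *: \sum_b k 0 b *: T a b.
    rewrite /W yE; under eq_bigr => a _ do under eq_bigr => b _ do
      rewrite !mxE !big_ord1 !mxE scalerDl.
    under eq_bigr => a _ do rewrite big_split /=.
    rewrite big_split /= exchange_big -big_split /=; apply: eq_bigr => a _.
    rewrite scaler_sumr -big_split /=; apply: eq_bigr => b _.
    by rewrite symT -scalerDl scalerA; congr (_ *: _); ring.
  rewrite mulmx_suml; apply: summx_sub => a _.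
  by rewrite -scalemxAl; exact: scalemx_sub (TP a).
(* Subtracting the tangent vector [z *m J] moves [W] into [N] without changing its normal part. *)
have [W' WE W'P] : exists2 W', W = W' + z *m J & W' *m P = 0.
  exists (W - z *m J); first by rewrite subrK.
  by rewrite mulmxBl zE -mulmxA subrr.
pose c := W' *m G *m J^T *m invmx I.
have HE' : H = W' - c *m J.
  rewrite HE WE !mulmxDl opprD addrACA -/c.
  have -> : z *m J *m G *m J^T *m invmx I = z.
    by rewrite -!mulmxA (mulmxA G) (mulmxA J) (mulmxA J G) -IE mulmxV // mulmx1.
  by rewrite subrr addr0.
have cI : c *m I = W' *m G *m J^T by rewrite /c mulmxKV.
clearbody c.
(* The tangential part of [W'] is orthogonal to [k *m J], as [W'] and [k *m J] lie in [N]. So the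
   nonzero covector [m] annihilates both [c] and [k], which makes them proportional. *)
have /submxP[r cE] : (c <= k)%MS.
  pose m := k *m I.
  have m0 : m != 0.
    by apply: contraNneq k0 => m0; rewrite -(mulmxK uI k) -/m m0 mul0mx.
  have mk : m 0 0 * k 0 0 + m 0 1 * k 0 1 = 0.
    by have /matrixP/(_ 0 0) := kIk; rewrite mxE sum_ord2 !mxE.
  have mc : m 0 0 * c 0 0 + m 0 1 * c 0 1 = 0.
    have : m *m c^T = 0.
      have /(congr1 trmx) := nullP _ _ W'P kJP; rewrite trmx0 => <-.
      rewrite (trmx_mul k) mulmxA -cI -mulmxA trmx_mul (trmx_mul I) trmxK.
      by rewrite symI.
    by move=> /matrixP/(_ 0 0); rewrite mxE sum_ord2 !mxE.
  apply: colinear_row2 => //.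
  have [m00|m00] := eqVneq (m 0 0) 0.
    have m01 : m 0 1 != 0.
      apply: contraNneq m0 => m01; apply/eqP/rowP => j; rewrite [RHS]mxE.
      by case: (ord2P j) => ->.
    move: mk mc; rewrite m00 !mul0r !add0r => /eqP; rewrite mulf_eq0.
    rewrite (negPf m01) => /eqP -> /eqP; rewrite mulf_eq0 (negPf m01).
    by move=> /eqP ->; rewrite mulr0 mul0r.
  apply: (mulfI m00); apply/eqP; rewrite -subr_eq0; apply/eqP.
  transitivity (k 0 1 * (m 0 0 * c 0 0 + m 0 1 * c 0 1)
    - c 0 1 * (m 0 0 * k 0 0 + m 0 1 * k 0 1)); first by ring.
  by rewrite mk mc; ring.
have HP : H *m P = 0.
  by rewrite HE' cE mulmxBl W'P -!mulmxA (mulmxA k) kJP mulmx0 subrr.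
exact: nullP.
Qed.

End LinearAlgebra.

(** * The neutral metric *)

(** Contraction with [g] cancels the inverse matrix and leaves the Christoffel symbols of the first
    kind. *)
Lemma christoffel_lower (R : realType) (n : nat) (g : 'rV[R]_n -> 'M[R]_n)
    (x : 'rV[R]_n) (i j l : 'I_n) : (g x)^T = g x -> g x \in unitmx ->
  \sum_k christoffel g x k i j * g x k l =
  2^-1 * ('D_(delta_mx 0 i) (fun y => g y j l) x
     + 'D_(delta_mx 0 j) (fun y => g y i l) x
     - 'D_(delta_mx 0 l) (fun y => g y i j) x).
Proof.
move=> symg ug.
under eq_bigr => k _ do rewrite /christoffel -mulrA mulr_suml.
rewrite -mulr_sumr exchange_big /=; congr (_ * _).
rewrite (bigD1 l) //= [X in _ + X]big1 => [|m ml].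
  under eq_bigr => k _ do rewrite mulrAC.
  rewrite -mulr_suml addr0 -[RHS]mul1r; congr (_ * _).
  have /matrixP/(_ l l) : (invmx (g x))^T *m g x = 1%:M.
    by rewrite trmx_inv symg mulVmx.
  by rewrite !mxE eqxx => h; rewrite -[RHS]h;
    apply: eq_bigr => k _; rewrite mxE.
under eq_bigr => k _ do rewrite mulrAC.
rewrite -mulr_suml; apply/eqP; rewrite mulf_eq0; apply/orP; left; apply/eqP.
have /matrixP/(_ m l) : (invmx (g x))^T *m g x = 1%:M.
  by rewrite trmx_inv symg mulVmx.
by rewrite !mxE (negPf ml) => h; rewrite -[RHS]h;
    apply: eq_bigr => k _; rewrite mxE.
Qed.

Section NeutralMetric.
Variable R : realType.
Implicit Types (c : bool * bool) (x : 'rV[R]_(2 + 2)) (e : bool).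

(* [false] embeds the coordinates of [z1], [true] those of [z2]. *)
Definition emb e : 'I_2 -> 'I_(2 + 2) := if e then @rshift 2 2 else @lshift 2 2.

(* Real and imaginary parts of [1 + z1 * conjc z2] or of [z1 + conjc z2]. *)
Definition den_re c x : R :=
  if c.1 == c.2 then 1 + (x 0 (emb false 0) * x 0 (emb true 0)
    + x 0 (emb false 1) * x 0 (emb true 1))
  else x 0 (emb false 0) + x 0 (emb true 0).

Definition den_im c x : R :=
  if c.1 == c.2 then x 0 (emb false 1) * x 0 (emb true 0)
    - x 0 (emb false 0) * x 0 (emb true 1)
  else x 0 (emb false 1) - x 0 (emb true 1).

Definition den_sqnorm c x : R := den_re c x ^+ 2 + den_im c x ^+ 2.

Definition coef_sgn c : R := if c.1 == c.2 then 1 else - 1.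

(* [coef_re + i * coef_im] is half the coefficient of d z1 * d (conjc z2): it
   absorbs the 1 / 2 of the symmetrised product. *)
Definition coef_re c x : R :=
  coef_sgn c * (den_re c x ^+ 2 - den_im c x ^+ 2) * (den_sqnorm c x)^-1 ^+ 2.

Definition coef_im c x : R :=
  coef_sgn c * (- (2 * den_re c x * den_im c x)) * (den_sqnorm c x)^-1 ^+ 2.

(** The inverse is the conjugate over the squared norm; at [p = q = 0] both sides are zero because
    [0^-1 = 0]. *)
Lemma inv_sqrE (p q : R) (Z : R[i]) :
  2 / (p +i* q)%C ^+ 2 * (Z / 2) =
  (((p ^+ 2 - q ^+ 2) * (p ^+ 2 + q ^+ 2)^-1 ^+ 2) +i*
   ((- (2 * p * q)) * (p ^+ 2 + q ^+ 2)^-1 ^+ 2))%C * Z.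
Proof.
have two : (2 : R[i]) != 0 by rewrite pnatr_eq0.
have -> : 2 / (p +i* q)%C ^+ 2 * (Z / 2) = (p +i* q)%C^-1 ^+ 2 * Z.
  by rewrite -exprVn; move: (p +i* q)%C^-1 => d; field.
congr (_ * Z); apply/eqP; rewrite eq_complex !expr2 /= !expr2.
by apply/andP; split; apply/eqP; ring.
Qed.

Lemma neutral_formE c x (X1 X2 Y1 Y2 : R[i]) :
  neutral_form c (complexify (lsubmx x)) (complexify (rsubmx x)) X1 X2 Y1 Y2 =
  complex.Im ((coef_re c x +i* coef_im c x)%C *
    (X1 * conjc Y2 + Y1 * conjc X2)).
Proof.
rewrite /neutral_form.
have D1 : (1 + complexify (lsubmx x) * conjc (complexify (rsubmx x)) =
  (1 + (x 0 (emb false 0) * x 0 (emb true 0)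
    + x 0 (emb false 1) * x 0 (emb true 1))) +i*
  (x 0 (emb false 1) * x 0 (emb true 0)
    - x 0 (emb false 0) * x 0 (emb true 1)))%C.
  apply/eqP; rewrite eq_complex /complexify !mxE /=.
  by apply/andP; split; apply/eqP; ring.
have D2 : (complexify (lsubmx x) + conjc (complexify (rsubmx x)) =
  (x 0 (emb false 0) + x 0 (emb true 0)) +i*
  (x 0 (emb false 1) - x 0 (emb true 1)))%C.
  by rewrite /complexify !mxE.
rewrite D1 D2.
rewrite /coef_re /coef_im /den_sqnorm /den_re /den_im /coef_sgn.
case: ifP => _; first by rewrite inv_sqrE !mul1r.
rewrite !mulNr inv_sqrE -[X in complex.Im X = _]mulNr.
congr (complex.Im (_ * _)).
by apply/eqP; rewrite eq_complex /= !mul1r !mulNr !eqxx.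
Qed.

Lemma neutral_metric_sym c x : (neutral_metric c x)^T = neutral_metric c x.
Proof.
by apply/matrixP => i j; rewrite !mxE /= !neutral_formE addrC.
Qed.

(** The form pairs only [X1] with [Y2] and [Y1] with [X2], so the tangent plane of each factor is
    totally null. *)
Lemma neutral_metric_diag c x e (i j : 'I_2) :
  neutral_metric c x (emb e i) (emb e j) = 0.
Proof.
rewrite mxE /= neutral_formE.
have half0 (e' : bool) (k : 'I_2) :
    complexify ((if e' then lsubmx else rsubmx) (delta_mx 0 (emb e' k))) = 0
      :> R[i].
  case: e'; rewrite /complexify !mxE /= ?eq_lrshift ?eq_rlshift /=; done.
have := half0 e i; have := half0 e j.
by case: e => -> ->; rewrite ?conjc0 !(mul0r, mulr0) addr0 mulr0.
Qed.

Lemma neutral_metricE c x (i j : 'I_2) :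
  neutral_metric c x (emb false i) (emb true j) =
  if i == j then coef_im c x
  else if i == 0 then - coef_re c x else coef_re c x.
Proof.
rewrite mxE /= neutral_formE.
have -> : lsubmx (delta_mx 0 (lshift 2 i)) = delta_mx 0 i :> 'rV[R]_2.
  by apply/rowP => k; rewrite !mxE eq_lshift.
have -> : rsubmx (delta_mx 0 (rshift 2 j)) = delta_mx 0 j :> 'rV[R]_2.
  by apply/rowP => k; rewrite !mxE eq_rshift.
have -> : rsubmx (delta_mx 0 (lshift 2 i)) = 0 :> 'rV[R]_2.
  by apply/rowP => k; rewrite !mxE eq_rlshift andbF.
have -> : lsubmx (delta_mx 0 (rshift 2 j)) = 0 :> 'rV[R]_2.
  by apply/rowP => k; rewrite !mxE eq_lrshift andbF.
rewrite /complexify !mxE /=.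
by case: (ord2P i) => ->; case: (ord2P j) => -> /=; ring.
Qed.

Lemma sum_emb (V : nmodType) e (F : 'I_(2 + 2) -> V) :
  \sum_i F i = \sum_i F (emb e i) + \sum_i F (emb (~~ e) i).
Proof. by rewrite big_split_ord /=; case: e => //=; rewrite addrC. Qed.

Lemma embP e (i : 'I_(2 + 2)) :
  (exists j, i = emb e j) \/ (exists j, i = emb (~~ e) j).
Proof.
by case: (split_ordP i) => j ->; case: e;
  [right | left | left | right]; exists j.
Qed.

Lemma coef_sqnorm c x :
  coef_re c x ^+ 2 + coef_im c x ^+ 2 = (den_sqnorm c x)^-1 ^+ 2.
Proof.
have [n0|n0] := eqVneq (den_sqnorm c x) 0.
  by rewrite /coef_re /coef_im n0 invr0 expr0n /= !mulr0 expr0n addr0.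
have s2 : coef_sgn c ^+ 2 = 1.
  by rewrite /coef_sgn; case: ifP; rewrite ?sqrrN expr1n.
transitivity
  (coef_sgn c ^+ 2 * (den_sqnorm c x) ^+ 2 * (den_sqnorm c x)^-1 ^+ 4).
  by rewrite /coef_re /coef_im [X in _ * X ^+ 2 * _]/den_sqnorm; ring.
by rewrite s2; field.
Qed.

(** The off-diagonal blocks are a similarity matrix and its transpose, so the square of the metric
    matrix is scalar. *)
Lemma neutral_metric_unit c x : den_sqnorm c x != 0 ->
  neutral_metric c x \in unitmx.
Proof.
move=> n0; set G := neutral_metric c x.
have Gll i j : G (lshift 2 i) (lshift 2 j) = 0.
  exact: neutral_metric_diag false i j.
have Grr i j : G (rshift 2 i) (rshift 2 j) = 0.
  exact: neutral_metric_diag true i j.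
have Glr i j : G (lshift 2 i) (rshift 2 j) = _ := neutral_metricE c x i j.
have Grl i j : G (rshift 2 j) (lshift 2 i) = G (lshift 2 i) (rshift 2 j).
  by rewrite /G -{1}(neutral_metric_sym c x) mxE.
have GG : G *m G = ((den_sqnorm c x)^-1 ^+ 2)%:M.
  apply/matrixP => i j; rewrite -coef_sqnorm !mxE (sum_emb false) !sum_ord2 /=.
  case: (split_ordP i) => {}i ->; case: (split_ordP j) => {}j ->;
    rewrite ?(Gll, Grr, Grl, Glr, eq_lshift, eq_rshift, eq_lrshift, eq_rlshift)
      ?(mul0r, mulr0, addr0, add0r) //;
    by case: (ord2P i) => ->; case: (ord2P j) => -> /=; ring.
have /mulmx1_unit[] // : G *m (den_sqnorm c x ^+ 2 *: G) = 1%:M.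
by rewrite -scalemxAr GG scale_scalar_mx -exprMn divff // expr1n.
Qed.

(** Its kernel on row vectors is the tangent plane of the other factor: the plane [N] when factor
    [e] has the vanishing determinant. *)
Definition emb_mx e : 'M[R]_(2 + 2, 2) := colsub (emb e) 1%:M.

Lemma mul_emb_mx m e (A : 'M[R]_(m, 2 + 2)) :
  A *m emb_mx e = (if e then rsubmx else lsubmx) A.
Proof.
rewrite mulmx_colsub mulmx1; apply/matrixP => i j; rewrite mxE /emb.
by case: e; rewrite mxE.
Qed.

Lemma emb_mx_eq0P e (v : 'rV[R]_(2 + 2)) :
  (v *m emb_mx e = 0) <-> (forall i, v 0 (emb e i) = 0).
Proof.
rewrite mulmx_colsub mulmx1; split=> [/rowP v0 i|v0].
  by have := v0 i; rewrite !mxE.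
by apply/rowP => i; rewrite !mxE v0.
Qed.

Lemma neutral_metric_null c x e (v w : 'rV[R]_(2 + 2)) :
  v *m emb_mx e = 0 -> w *m emb_mx e = 0 ->
  v *m neutral_metric c x *m w^T = 0.
Proof.
move=> /emb_mx_eq0P v0 /emb_mx_eq0P w0; apply/matrixP => i j.
rewrite !ord1 !mxE big1 // => k _; rewrite !mxE.
case: (embP e k) => [] [{}k ->]; first by rewrite w0 mulr0.
rewrite (sum_emb e) !big1 ?addr0 ?mul0r // => l _; last by rewrite v0 mul0r.
by rewrite neutral_metric_diag mulr0.
Qed.

(** The part [w] of [v] along factor [e] is orthogonal to everything: to factor [e] by nullity, and
    to the other factor because its pairings there are those of [v]. *)
Lemma neutral_metric_perp c x e (v : 'rV[R]_(2 + 2)) :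
  den_sqnorm c x != 0 ->
  (forall j, (v *m neutral_metric c x) 0 (emb (~~ e) j) = 0) ->
  v *m emb_mx e = 0.
Proof.
move=> n0 vG; have uG := neutral_metric_unit n0.
pose w := v *m emb_mx e *m (emb_mx e)^T.
have wE i : w 0 (emb e i) = v 0 (emb e i).
  rewrite /w mulmx_colsub mulmx1 mxE (bigD1 i) //= !mxE eqxx mulr1.
  rewrite big1 ?addr0 //.
  move=> j ji; rewrite !mxE /emb.
  by case: (e); rewrite ?eq_lshift ?eq_rshift eq_sym (negPf ji) mulr0.
have wE' i : w 0 (emb (~~ e) i) = 0.
  rewrite /w mulmx_colsub mulmx1 mxE big1 // => j _; rewrite !mxE.
  by case: (e); rewrite /= ?eq_lrshift ?eq_rlshift mulr0.
have w0 : w = 0.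
  rewrite -(mulmxK uG w); set wG := w *m _; suff -> : wG = 0 by rewrite mul0mx.
  apply/rowP => l; rewrite [RHS]mxE.
  case: (embP e l) => [] [i ->].
    rewrite mxE (sum_emb e) !big1 ?addr0 // => j _.
      by rewrite wE' mul0r.
    by rewrite neutral_metric_diag mulr0.
  rewrite -[RHS](vG i) !mxE !(sum_emb e); congr (_ + _); apply: eq_bigr => j _.
    by rewrite wE.
  by rewrite !neutral_metric_diag !mulr0.
by apply/emb_mx_eq0P => i; rewrite -wE w0 mxE.
Qed.

(** * Cauchy-Riemann equations of the coefficient and parallel null planes *)

Lemma is_derive_coord (x v : 'rV[R]_(2 + 2)) k :
  is_derive x v (fun y => y 0 k) (v 0 k).
Proof.
apply: DeriveDef; first exact/diff_derivable/differentiable_coord.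
have /matrixP/(_ 0 k) := derive_mx (@derivable_id _ _ x v).
by rewrite derive_id mxE.
Qed.

Lemma is_derive_coef c (x v : 'rV[R]_(2 + 2)) (dp dq : R) :
  den_sqnorm c x != 0 ->
  is_derive x v (den_re c) dp -> is_derive x v (den_im c) dq ->
  let p := den_re c x in let q := den_im c x in let n := den_sqnorm c x in
  is_derive x v (coef_re c)
    (coef_sgn c * 2 * (p * dp - q * dq) * n^-1 ^+ 2 -
     coef_sgn c * 4 * (p ^+ 2 - q ^+ 2) * (p * dp + q * dq) * n^-1 ^+ 3) /\
  is_derive x v (coef_im c)
    (- coef_sgn c * 2 * (p * dq + q * dp) * n^-1 ^+ 2 +
     coef_sgn c * 8 * p * q * (p * dp + q * dq) * n^-1 ^+ 3).
Proof.
move=> n0 hp hq p q n.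
have hn : is_derive x v (den_sqnorm c) (2 * p * dp + 2 * q * dq).
  apply: (@is_derive_eq _ _ _ (den_re c ^+ 2 + den_im c ^+ 2)).
  by rewrite /= /GRing.scale /= -/p -/q; ring.
have hn' : is_derive x v (fun y => (den_sqnorm c y)^-1)
    (- n ^- 2 * (2 * p * dp + 2 * q * dq)).
  apply: DeriveDef; first by apply: derivableV => //; case: hn.
  by rewrite deriveV //; case: hn => _ ->.
split.
  apply: (@is_derive_eq _ _ _ (coef_sgn c \*: (den_re c ^+ 2 - den_im c ^+ 2)
    * (fun y => (den_sqnorm c y)^-1) ^+ 2)).
  by rewrite /= !fctE /GRing.scale /= -/p -/q -/n -exprVn; ring.
apply: (@is_derive_eq _ _ _ (coef_sgn c \*: (- (2 \*: den_re c * den_im c))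
  * (fun y => (den_sqnorm c y)^-1) ^+ 2)).
by rewrite /= !fctE /GRing.scale /= -/p -/q -/n -exprVn -[2 *: p]/(2 * p); ring.
Qed.

Lemma is_derive_den_re c (x v : 'rV[R]_(2 + 2)) :
  is_derive x v (den_re c)
    (if c.1 == c.2 then
       x 0 (emb false 0) * v 0 (emb true 0)
       + x 0 (emb true 0) * v 0 (emb false 0)
       + (x 0 (emb false 1) * v 0 (emb true 1)
          + x 0 (emb true 1) * v 0 (emb false 1))
     else v 0 (emb false 0) + v 0 (emb true 0)).
Proof.
have dx := is_derive_coord x v.
rewrite /den_re; case: (c.1 == c.2); last exact: is_deriveD.
have := is_deriveD (is_derive_cst (1 : R) x v)
  (is_deriveD (is_deriveM (dx (emb false 0)) (dx (emb true 0)))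
    (is_deriveM (dx (emb false 1)) (dx (emb true 1)))).
by rewrite add0r.
Qed.

Lemma is_derive_den_im c (x v : 'rV[R]_(2 + 2)) :
  is_derive x v (den_im c)
    (if c.1 == c.2 then
       x 0 (emb false 1) * v 0 (emb true 0)
       + x 0 (emb true 0) * v 0 (emb false 1)
       - (x 0 (emb false 0) * v 0 (emb true 1)
          + x 0 (emb true 1) * v 0 (emb false 0))
     else v 0 (emb false 1) - v 0 (emb true 1)).
Proof.
have dx := is_derive_coord x v.
rewrite /den_im; case: (c.1 == c.2); last exact: is_deriveB.
exact: is_deriveB (is_deriveM (dx (emb false 1)) (dx (emb true 0)))
  (is_deriveM (dx (emb false 0)) (dx (emb true 1))).
Qed.

(** The denominator is affine in [z1] and in [conjc z2]; the sign [s] accounts for the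
    conjugation. *)
Lemma den_CR c x e :
  let s : R := if e then -1 else 1 in
  'D_(delta_mx 0 (emb e 1)) (den_re c) x =
    - s * 'D_(delta_mx 0 (emb e 0)) (den_im c) x /\
  'D_(delta_mx 0 (emb e 1)) (den_im c) x =
    s * 'D_(delta_mx 0 (emb e 0)) (den_re c) x.
Proof.
have Dre v := @derive_val _ _ _ _ _ _ _ (is_derive_den_re c x v).
have Dim v := @derive_val _ _ _ _ _ _ _ (is_derive_den_im c x v).
rewrite /= !Dre !Dim !mxE; case: (c.1 == c.2); case: (e);
  rewrite /= ?(eq_lrshift, eq_rlshift, eq_lshift, eq_rshift) /=;
  by split; ring.
Qed.

(* Cauchy-Riemann equations in [z1] ([e = false]) and, as the coefficient is
   antiholomorphic in [z2], in [conjc z2] ([e = true]). *)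
Lemma coef_CR c x e :
  den_sqnorm c x != 0 ->
  let s : R := if e then -1 else 1 in
  'D_(delta_mx 0 (emb e 1)) (coef_re c) x =
    - s * 'D_(delta_mx 0 (emb e 0)) (coef_im c) x /\
  'D_(delta_mx 0 (emb e 1)) (coef_im c) x =
    s * 'D_(delta_mx 0 (emb e 0)) (coef_re c) x.
Proof.
move=> n0 s.
have D v := is_derive_coef n0
  (@derivableP _ _ _ _ x v (@ex_derive _ _ _ _ _ _ _ (is_derive_den_re c x v)))
  (@derivableP _ _ _ _ x v (@ex_derive _ _ _ _ _ _ _ (is_derive_den_im c x v))).
have [CR1 CR2] := den_CR c x e.
have [[_ ->] [_ ->]] := D (delta_mx 0 (emb e 0)).
have [[_ ->] [_ ->]] := D (delta_mx 0 (emb e 1)).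
rewrite CR1 CR2 -/s; move: n0; rewrite /den_sqnorm.
move: (den_re c x) (den_im c x) ('D__ _ _) ('D__ _ _) => p q dp dq n0.
by split; field.
Qed.

Lemma derivable_coef_re c x v : den_sqnorm c x != 0 ->
  derivable (coef_re c) x v.
Proof.
move=> n0.
by have [[]] := is_derive_coef n0 (is_derive_den_re c x v)
  (is_derive_den_im c x v).
Qed.

Lemma neutral_metric_cross c x e (i j : 'I_2) :
  neutral_metric c x (emb (~~ e) i) (emb e j) =
  if i == j then coef_im c x
  else if (i == 0) == e then - coef_re c x else coef_re c x.
Proof.
case: e; first by rewrite neutral_metricE eqb_id.
rewrite -neutral_metric_sym mxE neutral_metricE.
by case: (ord2P i) => ->; case: (ord2P j) => ->.
Qed.

(** The denominator vanishes on the reflected diagonal. There the convention [0^-1 = 0] makes the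
    metric zero, so non-degeneracy of the induced metric excludes such points. *)
Lemma neutral_metric_eq0 c x :
  den_sqnorm c x = 0 -> neutral_metric c x = 0.
Proof.
move=> n0; have re0 : coef_re c x = 0.
  by rewrite /coef_re n0 invr0 expr0n mulr0.
have im0 : coef_im c x = 0 by rewrite /coef_im n0 invr0 expr0n mulr0.
apply/matrixP => i j; rewrite [RHS]mxE.
have [e [k ->]] : exists e k, i = emb e k.
  by case: (embP false i) => h; [exists false | exists true].
case: (embP e j) => [] [l ->]; first exact: neutral_metric_diag.
have := neutral_metric_cross c x (~~ e) k l; rewrite negbK re0 im0 oppr0 => ->.
by case: ifP => // _; case: ifP.
Qed.

(** For fixed [i] the entries are the components of the imaginary part of a constant times [h d z1]
    or [h d (conjc z2)], which is closed along factor [e] by the Cauchy-Riemann equations. *)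
Lemma derive_neutral_metric_sym c x e (i j l : 'I_2) :
  den_sqnorm c x != 0 ->
  'D_(delta_mx 0 (emb e j))
    (fun y => neutral_metric c y (emb (~~ e) i) (emb e l)) x =
  'D_(delta_mx 0 (emb e l))
    (fun y => neutral_metric c y (emb (~~ e) i) (emb e j)) x.
Proof.
move=> n0; have [CR1 CR2] := coef_CR e n0.
have gE k : (fun y => neutral_metric c y (emb (~~ e) i) (emb e k)) =
    if i == k then coef_im c
    else if (i == 0) == e then - coef_re c else coef_re c.
  apply/funext => y; rewrite neutral_metric_cross.
  by case: ifP => // _; case: ifP.
have dN v : 'D_v (- coef_re c) x = - 'D_v (coef_re c) x.
  exact/deriveN/derivable_coef_re.
rewrite !gE.
by case: (ord2P i) => ->; case: (ord2P j) => ->; case: (ord2P l) => ->;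
  case: (e) CR1 CR2 => /= CR1 CR2;
  rewrite ?dN ?CR1 ?CR2 ?opprK ?mul1r ?mulN1r ?opprK.
Qed.

Lemma christoffel_neutral_null c x e (a b : 'rV[R]_(2 + 2)) :
  den_sqnorm c x != 0 -> b *m emb_mx e = 0 ->
  (\row_k \sum_i \sum_j christoffel (neutral_metric c) x k i j * a 0 i * b 0 j)
    *m emb_mx e = 0.
Proof.
move=> n0 /emb_mx_eq0P b0; apply: (neutral_metric_perp n0) => l.
have uG := neutral_metric_unit n0; have symG := neutral_metric_sym c x.
rewrite mxE.
under eq_bigr => k _ do rewrite mxE mulr_suml.
rewrite exchange_big big1 //= => i _.
under eq_bigr => k _ do rewrite mulr_suml.
rewrite exchange_big big1 //= => j _.
transitivity (a 0 i * b 0 j * \sum_k christoffel (neutral_metric c) x k i j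
    * neutral_metric c x k (emb (~~ e) l)).
  by rewrite mulr_sumr; apply: eq_bigr => k _; ring.
rewrite christoffel_lower //.
have dg0 (v : 'rV[R]_(2 + 2)) (r s : 'I_2) :
    'D_v (fun y => neutral_metric c y (emb (~~ e) r) (emb (~~ e) s)) x = 0.
  rewrite (_ : (fun _ => _) = cst 0) ?derive_cst //.
  by apply/funext => y; rewrite neutral_metric_diag.
(* Only [j] in the factor of [l] matters, which kills the first derivative. The other two cancel by
   closedness if [i] is in factor [e], and vanish if not. *)
case: (embP e j) => [] [r ->]; first by rewrite b0 mulr0 mul0r.
case: (embP e i) => [] [s ->].
  have := @derive_neutral_metric_sym c x (~~ e) s r l n0.
  by rewrite negbK dg0 add0r => ->; rewrite subrr !mulr0.
by rewrite !dg0 addr0 subrr !mulr0.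
Qed.

End NeutralMetric.
(** * Surfaces with a degenerate projection *)

Lemma det_mx2 (R : comNzRingType) (A : 'M[R]_2) :
  \det A = A 0 0 * A 1 1 - A 0 1 * A 1 0.
Proof.
rewrite (expand_det_row _ 0) !big_ord_recl big_ord0 addr0 /cofactor !det_mx11.
rewrite !mxE /= expr0 expr1 mul1r mulN1r mulrN.
by congr (A _ _ * A _ _ - A _ _ * A _ _); apply/val_inj.
Qed.

Section SmoothMap.
Variables (R : realType) (m n : nat) (U : set 'rV[R]_m).
Variable F : 'rV[R]_m -> 'rV[R]_n.
Hypotheses (oU : open U) (smF : smooth_on U F).

Lemma smooth_jacobianE x a : U x -> row a ('J F x) = partial a F x.
Proof.
by move=> Ux; rewrite /partial deriveEjacobian ?rowE //; exact: (smF [::] Ux).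
Qed.

Lemma smooth_partial_coord x a i : U x ->
  differentiable (fun y => partial a F y 0 i) x.
Proof.
move=> Ux; apply: (@differentiable_comp _ _ _ _ (partial a F) (fun v => v 0 i)).
  exact: (smF [:: a] Ux).
exact: differentiable_coord.
Qed.

Lemma derive_coord k (f : 'rV[R]_k -> 'rV[R]_n) x v i : differentiable f x ->
  'D_v (fun y => f y 0 i) x = 'D_v f x 0 i.
Proof. by move=> /diff_derivable/derive_mx ->; rewrite mxE. Qed.

Lemma partial_partial_sym x a b : U x ->
  partial a (partial b F) x = partial b (partial a F) x.
Proof.
move=> Ux; have nU : \forall y \near x, U y by exact: open_nbhs_nbhs.
apply/rowP => i.
have dE c d : partial c (partial d F) x 0 i =
    'D_(delta_mx 0 c) (fun y => partial d F y 0 i) x.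
  by rewrite derive_coord //; exact: (smF [:: d] Ux).
apply: etrans (dE a b) _; apply: etrans _ (esym (dE b a)).
apply: (@derive_derive_sym _ _ (fun y => F y 0 i)).
- apply: filterS nU => y Uy.
  apply: (@differentiable_comp _ _ _ _ F (fun v => v 0 i)).
    exact: (smF [::] Uy).
  exact: differentiable_coord.
- by apply: filterS nU => y Uy; rewrite derive_coord //; exact: (smF [::] Uy).
- by apply: filterS nU => y Uy; rewrite derive_coord //; exact: (smF [::] Uy).
- exact: smooth_partial_coord.
- exact: smooth_partial_coord.
Qed.

Lemma christoffel_sym (g : 'rV[R]_n -> 'M[R]_n) x k i j :
  (forall y, (g y)^T = g y) -> christoffel g x k i j = christoffel g x k j i.
Proof.
move=> symg; have gC : (fun y => g y i j) = (fun y => g y j i).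
  by apply/funext => y; have /matrixP/(_ j i) := symg y; rewrite mxE.
rewrite /christoffel; congr (_ * _); apply: eq_bigr => l _; congr (_ * _).
by rewrite gC [X in X - _]addrC.
Qed.

Lemma covariant_derivative_sym (g : 'rV[R]_n -> 'M[R]_n) x a b :
  (forall y, (g y)^T = g y) -> U x ->
  covariant_derivative g F x a b = covariant_derivative g F x b a.
Proof.
move=> symg Ux; rewrite /covariant_derivative partial_partial_sym //.
congr (_ + _); apply/rowP => k; rewrite !mxE exchange_big /=.
apply: eq_bigr => i _; apply: eq_bigr => j _; rewrite mulrAC.
by rewrite christoffel_sym.
Qed.

End SmoothMap.

(** The Jacobian determinant of one projection, written with [partial] so that [smooth_on] controls
    its entries. *)
Definition partial_det (R : realType) (F : 'rV[R]_2 -> 'rV[R]_(2 + 2)) e y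
    : R :=
  \det (\matrix_(a < 2, i < 2) partial a F y 0 (emb e i)).

Section SurfacePatch.
Variables (R : realType) (U : set 'rV[R]_2) (F : 'rV[R]_2 -> 'rV[R]_(2 + 2)).
Hypotheses (oU : open U) (smF : smooth_on U F).

Lemma partial_detE x e : U x -> partial_det F e x = \det ('J F x *m emb_mx R e).
Proof.
move=> Ux; congr (\det _); apply/matrixP => a i.
rewrite mulmx_colsub mulmx1 mxE [RHS]mxE -(smooth_jacobianE smF a Ux).
by rewrite mxE.
Qed.

(** The terms are arranged to match the hypothesis of [kermx_deriv_det]. *)
Lemma partial_det_is_derive x e v : U x ->
  is_derive x v (partial_det F e) (
   let f a i := partial a F x 0 (emb e i) in
   let df a i := 'D_v (partial a F) x 0 (emb e i) in
   df 0 0 * f 1 1 + f 0 0 * df 1 1 - (df 0 1 * f 1 0 + f 0 1 * df 1 0)).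
Proof.
move=> Ux; have D a i : is_derive x v (fun y => partial a F y 0 (emb e i))
    ('D_v (partial a F) x 0 (emb e i)).
  apply: DeriveDef; first exact/diff_derivable/(smooth_partial_coord smF).
  by rewrite derive_coord //; exact: (smF [:: a] Ux).
have -> : partial_det F e =
   (fun y => partial 0 F y 0 (emb e 0)) * (fun y => partial 1 F y 0 (emb e 1)) -
   (fun y => partial 0 F y 0 (emb e 1)) * (fun y => partial 1 F y 0 (emb e 0)).
  by apply/funext => y; rewrite /partial_det det_mx2 !mxE.
have h := is_deriveB (is_deriveM (D 0 0) (D 1 1)) (is_deriveM (D 0 1) (D 1 0)).
apply: (@is_derive_eq _ _ _ _ _ _ _ _ h).
by congr (_ - _); rewrite addrC; congr (_ + _); exact: mulrC.
Qed.

Lemma partial_det_differentiable x e : U x ->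
  differentiable (partial_det F e) x.
Proof.
move=> Ux.
have D a i := smooth_partial_coord smF a (emb e i) Ux.
have -> : partial_det F e =
   (fun y => partial 0 F y 0 (emb e 0)) * (fun y => partial 1 F y 0 (emb e 1)) -
   (fun y => partial 0 F y 0 (emb e 1)) * (fun y => partial 1 F y 0 (emb e 0)).
  by apply/funext => y; rewrite /partial_det det_mx2 !mxE.
by apply: differentiableB; exact: differentiableM.
Qed.

Lemma mean_curvature_null c e x : U x ->
  induced_metric (neutral_metric c) F x \in unitmx ->
  'J F x *m emb_mx R e != 0 -> partial_det F e x = 0 ->
  (forall v, 'D_v (partial_det F e) x = 0) ->
  metric_sqnorm (neutral_metric c) (F x)
    (mean_curvature (neutral_metric c) F x) = 0.
Proof.
move=> Ux uI J0 pd0 dpd0.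
have n0 : den_sqnorm c (F x) != 0.
  apply: contraTneq uI => n0.
  have -> : induced_metric (neutral_metric c) F x = 0.
    by rewrite /induced_metric neutral_metric_eq0 ?mulmx0 ?mul0mx //; exact/eqP.
  by rewrite unitmxE det0 unitr0.
have /eqP/det0P[k k0 kJP] : \det ('J F x *m emb_mx R e) = 0.
  by rewrite -(partial_detE e Ux).
pose T := covariant_derivative (neutral_metric c) F x.
rewrite /metric_sqnorm.
have /matrixP/(_ 0 0) : mean_curvature (neutral_metric c) F x
    *m neutral_metric c (F x) *m (mean_curvature (neutral_metric c) F x)^T = 0.
  apply: (@null_trace _ _ _ _ _ (emb_mx R e) T k) => //.
  - exact: neutral_metric_sym.
  - by move=> v w; apply: neutral_metric_null.
  - by rewrite -mulmxA.
  - move=> a b.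
    exact: (covariant_derivative_sym oU smF a b (neutral_metric_sym c) Ux).
  move=> a.
  pose Hs : 'M[R]_(2, 2 + 2) := \matrix_b partial a (partial b F) x.
  (* The Christoffel terms lie in [N] because [k *m 'J F x] does, so only second derivatives of
     factor [e] remain. *)
  have -> : (\sum_b k 0 b *: T a b) *m emb_mx R e = k *m (Hs *m emb_mx R e).
    pose Gam b := \row_l \sum_i \sum_j
      christoffel (neutral_metric c) (F x) l i j * 'J F x a i * 'J F x b j.
    have -> : \sum_b k 0 b *: T a b = k *m Hs + \sum_b k 0 b *: Gam b.
      rewrite mulmx_sum_row -big_split /=; apply: eq_bigr => b _.
      by rewrite rowK -scalerDr.
    rewrite mulmxDl -mulmxA; set GG := (X in _ + X *m _).
    suff -> : GG *m emb_mx R e = 0 by rewrite addr0.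
    rewrite -[RHS](@christoffel_neutral_null _ c (F x) e (row a ('J F x))
      (k *m 'J F x)) //; last by rewrite -mulmxA.
    congr (_ *m _); apply/rowP => l; rewrite /GG summxE mxE.
    under eq_bigr => b _ do rewrite !mxE mulr_sumr.
    rewrite exchange_big /=; apply: eq_bigr => i _.
    under eq_bigr => b _ do rewrite mulr_sumr.
    rewrite exchange_big /=; apply: eq_bigr => j _.
    rewrite !mxE mulr_sumr; apply: eq_bigr => b _; ring.
  apply: kermx_deriv_det => //.
  rewrite -[RHS](dpd0 (delta_mx 0 a)).
  have [_ ->] := partial_det_is_derive e (delta_mx 0 a) Ux.
  have JE b i : ('J F x *m emb_mx R e) b i = partial b F x 0 (emb e i).
    by rewrite mulmx_colsub mulmx1 mxE -(smooth_jacobianE smF b Ux) [RHS]mxE.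
  have HE b i : (Hs *m emb_mx R e) b i = partial a (partial b F) x 0 (emb e i).
    by rewrite mulmx_colsub mulmx1 mxE [LHS]mxE.
  by rewrite !JE !HE.
by rewrite [X in _ = X -> _]mxE.
Qed.

End SurfacePatch.
Theorem theorem3 (R : realType) (M : smooth_surface R) (f : M -> LH3 R)
  (f_immersion : immersion f)
  (f_rank_one : rank_one f)
  (f_nondegenerate : nondegenerate_induced_metric f) :
  marginally_trapped f.
Proof.
move=> i c x Ux; have [oU smF _] := f_immersion i c.
(* Both ranks are at least their minimum 1, so neither block of the Jacobian is zero. *)
have rk e y : rep_dom f i c y -> (0 < \rank ('J (rep f i c) y *m emb_mx R e))%N.
  move=> /f_rank_one; rewrite mul_emb_mx; case: e => rk1;
    apply: (@leq_trans _ _ _ (eq_leq (esym rk1))).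
    exact: geq_minr.
  exact: geq_minl.
have J0 e : 'J (rep f i c) x *m emb_mx R e != 0.
  by rewrite -mxrank_eq0 -lt0n rk.
have null e := @mean_curvature_null _ _ _ oU smF c e x Ux
  (f_nondegenerate _ _ _ Ux) (J0 e).
have pq0 : \forall y \near x,
    partial_det (rep f i c) false y * partial_det (rep f i c) true y = 0.
  have : \forall y \near x, rep_dom f i c y by exact: open_nbhs_nbhs.
  apply: filterS => y Uy; apply/eqP; rewrite mulf_eq0 !(partial_detE smF) //.
  (* If both determinants were nonzero, both blocks would have rank 2, and so would the minimum. *)
  rewrite -[_ == 0]negbK -[X in _ || X]negbK -negb_and -!unitfE -!unitmxE.
  rewrite -!row_free_unit /row_free !mul_emb_mx.
  apply/negP => /andP[/eqP r1 /eqP r2].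
  by have := f_rank_one _ _ _ Uy; rewrite r1 r2.
(* Which factor vanishes to first order may depend on the point; [null] covers either choice. *)
have [] := factor_vanishes_order1 (partial_det_differentiable smF _ Ux)
  (partial_det_differentiable smF _ Ux) pq0 => -[p0 dp0];
  exact: null p0 dp0.
Qed.
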